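(* If $(k_n)_{n=1}^{\infty}$ is any sequence of positive integers satisfying $k_n=o(n)$, then $$\frac12\le\liminf_{n\to\infty}\frac{\mathbb{E}_{n,k_n}(L)}{\sqrt{k_n n}}\le\limsup_{n\to\infty}\frac{\mathbb{E}_{n,k_n}(L)}{\sqrt{k_n n}}\le 4e.$$ Moreover, for any $\epsilon>0$, $$\lim_{n\to\infty}\mathbb{P}_{n,k_n}\left(\frac12-\epsilon\le \frac{L}{\sqrt{k_n n}}\le 4e+\epsilon\right)=1.$$
   Context: For positive integers $k,n$, the $k$-card-minimum ($k$CM) procedure generates a random permutation of $\{1,\dots,n\}$ as follows. Let $D_1=\{1,\dots,n\}$. For $t=1,\dots,n$: given the past, $C_{t,1},\dots,C_{t,k}$ are i.i.d. uniform samples from $D_t$; $C_t=\min\{C_{t,1},\dots,C_{t,k}\}$; and $D_{t+1}=D_t\setminus\{C_t\}$. The resulting permutation is $\sigma=(C_1,\dots,C_n)$. $\mathbb{P}_{n,k}$ denotes the probability measure of this procedure with parameters $n,k$, and $\mathbb{E}_{n,k}$ denotes expectation under it. $L=L(\sigma)=\max\{\ell:\exists\,1\le i_1<\dots<i_\ell\le n \text{ with }\sigma(i_1)<\dots<\sigma(i_\ell)\}$ is the length of the longest increasing subsequence of $\sigma$. Here $e$ is the base of the natural logarithm. *)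

(* Defs.v *)
From HB Require Import structures.
From mathcomp Require Import all_boot all_order all_algebra.
From mathcomp Require Import all_classical all_reals all_analysis.

Set Implicit Arguments.
Unset Strict Implicit.
Unset Printing Implicit Defensive.

Import Order.TTheory GRing.Theory Num.Theory.
Import numFieldNormedType.Exports.

Local Open Scope ring_scope.

(* The cards 1, ..., n and the times 1, ..., n are both represented, in order,
   by the ordinals 0, ..., n - 1. *)

(* [w t j] is the j-th card sampled at time t. *)
Definition samples (n k : nat) := {ffun 'I_n -> {ffun 'I_k -> 'I_n}}.

(* The card C_t. The default value n of the minimum exceeds every card, so that
   this is the minimum of the k sampled cards as soon as 0 < k. *)
Definition selected (n k : nat) (w : samples n k) (t : 'I_n) : nat :=
  \big[minn/n]_(j < k) val (w t j).

(* The set D_t of the cards that are still available at time t. *)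
Definition available (n k : nat) (w : samples n k) (t : 'I_n) : {set 'I_n} :=
  [set c : 'I_n | [forall s : 'I_n, (s < t)%N ==> (selected w s != c)]].

(* The probability that the samples drawn by the procedure are w: by the chain
   rule, it is the product over t of the probability, given the samples drawn
   before t, that k independent uniform elements of D_t are w t 0, w t 1, etc.
   Note that D_t depends on the values of w at times s < t only. *)
Definition kCM_weight (R : realType) (n k : nat) (w : samples n k) : R :=
  \prod_(t < n) \prod_(j < k)
    (if w t j \in available w t then #|available w t|%:R^-1 else 0).

Definition kCM_prob (R : realType) (n k : nat) (A : pred (samples n k)) : R :=
  \sum_(w : samples n k | A w) kCM_weight R w.

Definition kCM_expect (R : realType) (n k : nat) (X : samples n k -> R) : R :=
  \sum_(w : samples n k) kCM_weight R w * X w.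

(* The length of the longest increasing subsequence of c: the maximum of the l
   for which there are i_1 < ... < i_l with c i_1 < ... < c i_l. *)
Definition lis (n : nat) (c : 'I_n -> nat) : nat :=
  \max_(l < n.+1 | [exists i : l.-tuple 'I_n,
                      sorted ltn (map val i) && sorted ltn (map c i)]) l.

Definition kCM_L (n k : nat) (w : samples n k) : nat := lis (selected w).

(* Main.v *)
Require Import Defs.
From HB Require Import structures.
From mathcomp Require Import all_boot all_order all_algebra.
From mathcomp Require Import all_classical all_reals all_analysis.
From mathcomp Require Import ring lra zify.

Set Implicit Arguments.
Unset Strict Implicit.
Unset Printing Implicit Defensive.

Import Order.TTheory GRing.Theory Num.Theory.
Import numFieldNormedType.Exports.

(** Why the theorem holds.  Replace the card C_t by its rank r_t (counted from
    0) in the set D_t of the remaining cards.  The sequence r_1, ..., r_n is the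
    Lehmer code of the permutation, and its entries are independent: with m
    cards left, r_t is the minimum of k uniform elements of {0, ..., m - 1}, so
    that P(r_t >= rho) = ((m - rho) / m) ^ k.  The length L is a function of the
    code, computed by a recursion ([code_lis]) whose only state is a rank rho:
    the longest increasing subsequence that uses cards of rank at least rho.
    This reduction is [kCM_expect_L]; what remains is to bound an exponential
    moment of L from either side, by induction along the recursion.

    Upper bound, [code_expect_expR_le]: E e^(2L) <= e^(8e sqrt(kn)).
    While half of the m current cards are drawn, X^L is at most the number of
    increasing subsequences counted with weight X^length.  Any given card is
    selected with probability at most k divided by the number of cards left,
    so the expected weighted count is at most (1 + a)^T (1 + b)^m for every
    a, b > 0 with a b >= X k / (m / 2), where T is the number of steps.  This
    is the bound of sum_l 'C(T, l) 'C(m, l) (a b)^l by the product of the two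
    binomial sums; it is reproduced directly by the recursion
    ([code_expect_block]).  With X = e^2 and balanced a, b, one half costs a
    factor e^(2e sqrt(km)), and the second half is the same procedure with m/2
    cards; the exponents close up because 2 + 8 * (3/4) = 8 and
    sqrt(1/2) <= 3/4.

    Lower bound, [code_expect_expRN_le]: with S = sqrt(kn) and x = sqrt(k/n),
    E e^(-2 l L) <= e^(- l S / ((1 + l)(1 + x))) for every l > 0.
    Build an increasing subsequence greedily, taking a card exactly when its
    rank is in the window [rho, rho + g) above the last card taken, with g about
    sqrt(n/k).  Each step with r_t < rho lowers rho by one and each card taken
    raises it by less than g, so rho >= 0 forces at least n - g N steps with
    r_t >= rho, where N is the number of cards taken.  Each of these steps takes
    a card with conditional probability at least p = x / (1 + x), so N is at
    least about p (n - g N), that is, N >= n / (1/p + g), about S / 2.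
    [code_expect_greedy] turns this count into an exponential moment bound.

    Both expectations follow from the moments by convexity ([kCM_jensen]) and
    both deviation probabilities by Markov's inequality ([kCM_markov]); the
    hypothesis k = o(n) enters only through x --> 0. *)

(** * Longest increasing subsequences and Lehmer codes *)

Fixpoint lis_above (x : nat) (s : seq nat) : nat :=
  if s is c :: s' then
    if c < x then lis_above x s'
    else maxn (lis_above c.+1 s').+1 (lis_above x s')
  else 0.

Lemma size_le_lis_above x s u :
  subseq u s -> all (leq x) u -> sorted ltn u -> size u <= lis_above x s.
Proof.
elim: s x u => [|c s IHs] x [|d u] //=.
case: eqVneq => [-> sub_us /andP[x_le_c xu] cu | _ sub_us xdu du].
  have c_ge_x : (c < x) = false by apply/negbTE; rewrite -leqNgt.
  rewrite c_ge_x; apply: leq_trans (leq_maxl _ _); rewrite ltnS.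
  by apply: IHs; rewrite ?(path_sorted cu) // (order_path_min ltn_trans cu).
have IHdu := IHs x (d :: u) sub_us xdu du.
by case: (ltnP c x) => // _; apply: leq_trans (leq_maxr _ _).
Qed.

Lemma lis_above_attained x s : exists u,
  [/\ subseq u s, all (leq x) u, sorted ltn u & size u = lis_above x s].
Proof.
elim: s x => [|c s IHs] x /=; first by exists [::].
have [u [sub_us xu su szu]] := IHs x.
have skip : subseq u (c :: s) := subseq_trans sub_us (subseq_cons s c).
case: ltnP => [_|x_le_c]; first by exists u.
case: leqP => _; first by exists u.
have [v [sub_vs cv sv szv]] := IHs c.+1.
exists (c :: v); split => /=; rewrite ?eqxx ?szv //.
  by rewrite x_le_c (sub_all _ cv) // => d; apply/leq_trans/ltnW.
by rewrite path_sortedE ?cv //; exact: ltn_trans.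
Qed.

(** The indices of an increasing subsequence, being sorted, form a subsequence
    of the enumeration of all indices; so its values form a subsequence of the
    list of values, and conversely through a selection mask. *)
Lemma lis_eq_lis_above n (c : 'I_n -> nat) :
  lis c = lis_above 0 [seq c t | t <- enum 'I_n].
Proof.
have enum_sorted : sorted (relpre val ltn) (enum 'I_n).
  by rewrite -sorted_map val_enum_ord iota_ltn_sorted.
have rel_trans : transitive (relpre (val : 'I_n -> nat) ltn).
  by move=> i j k; exact: ltn_trans.
apply/eqP; rewrite eqn_leq; apply/andP; split.
  apply/bigmax_leqP => l /existsP[i /andP[si sci]].
  rewrite -[X in X <= _](size_tuple i) -(size_map c).
  apply: size_le_lis_above => //; last exact/allP.
  apply: map_subseq.
  suff -> : tval i = [seq j <- enum 'I_n | j \in i] by exact: filter_subseq.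
  apply: (irr_sorted_eq rel_trans).
  - by move=> j; exact: ltnn.
  - by rewrite -sorted_map.
  - exact: sorted_filter.
  - by move=> j; rewrite mem_filter mem_enum andbT.
have [u [sub_u _ su szu]] := lis_above_attained 0 [seq c t | t <- enum 'I_n].
have [b sz_b def_u] := subseqP sub_u.
rewrite -map_mask in def_u.
have l_le_n : size u < n.+1.
  by rewrite ltnS (leq_trans (size_subseq sub_u)) // size_map size_enum_ord.
rewrite -szu (bigop.bigmax_sup (Ordinal l_le_n)) //=.
have sz_m : size (mask b (enum 'I_n)) == size u by rewrite def_u size_map.
apply/existsP; exists (Tuple sz_m) => /=.
by rewrite -def_u su andbT sorted_map (sorted_mask rel_trans).
Qed.

Fixpoint is_code (m : nat) (rs : seq nat) : bool :=
  if rs is r :: rs' then (r < m) && is_code m.-1 rs' else m == 0.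

Fixpoint cards_of_code (D rs : seq nat) : seq nat :=
  if rs is r :: rs' then
    nth 0 D r :: cards_of_code [seq d <- D | d != nth 0 D r] rs'
  else [::].

(** [lis_above] read on the code, with the threshold replaced by the number rho
    of remaining cards below it.  Drawing a card below the threshold lowers rho;
    a card of rank r that is taken leaves exactly r cards below the new
    threshold. *)
Fixpoint code_lis (rho : nat) (rs : seq nat) : nat :=
  if rs is r :: rs' then
    if r < rho then code_lis rho.-1 rs'
    else maxn (code_lis r rs').+1 (code_lis rho rs')
  else 0.

(** In a sorted list the entries below x come first. *)
Lemma nth_lt_count D r x : sorted ltn D -> r < size D ->
  (nth 0 D r < x) = (r < count (ltn^~ x) D).
Proof.
elim: D r => [|d D IHD] //= r sD.
have /allP dD := order_path_min ltn_trans sD.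
have [d_lt_x|x_le_d] := ltnP d x.
  by case: r => [|r] //= r_lt; rewrite IHD ?(path_sorted sD).
have /eqP -> : count (ltn^~ x) D == 0.
  rewrite -leqn0 leqNgt -has_count; apply/hasPn => e /dD d_lt_e.
  by rewrite /= -leqNgt (leq_trans x_le_d) // ltnW.
case: r => [|r] /= r_lt; first by rewrite ltnNge x_le_d.
by apply/negbTE; rewrite -leqNgt (leq_trans x_le_d) // ltnW // dD // mem_nth.
Qed.

Lemma count_lt_nth D r : sorted ltn D -> r < size D ->
  count (ltn^~ (nth 0 D r)) D = r.
Proof.
elim: D r => [|d D IHD] // [|r] sD r_lt /=;
  have /allP dD := order_path_min ltn_trans sD.
  rewrite ltnn; apply/eqP; rewrite -leqn0 leqNgt -has_count.
  by apply/hasPn => e /dD d_lt_e; rewrite /= -leqNgt ltnW.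
by rewrite IHD ?(path_sorted sD) // dD // mem_nth.
Qed.

Lemma size_filter_neq_nth D r : sorted ltn D -> r < size D ->
  size [seq d <- D | d != nth 0 D r] = (size D).-1.
Proof.
move=> sD r_lt; rewrite -rem_filter ?size_rem ?mem_nth //.
exact: sorted_uniq ltn_trans ltnn _ sD.
Qed.

(** Only ranks matter for the length: the threshold x is felt through the number
    of remaining cards below it. *)
Lemma lis_above_cards_of_code x D rs : sorted ltn D -> is_code (size D) rs ->
  lis_above x (cards_of_code D rs) = code_lis (count (ltn^~ x) D) rs.
Proof.
elim: rs x D => //= r rs IHrs x D sD /andP[r_lt code_rs].
set c := nth 0 D r; set D' := [seq d <- D | d != c].
have sD' : sorted ltn D' by exact: sorted_filter ltn_trans _ _ sD.
have {}code_rs : is_code (size D') rs by rewrite size_filter_neq_nth.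
have cntD' y : count (ltn^~ y) D' = count (ltn^~ y) D - (c < y).
  have -> : D' = rem c D.
    by rewrite rem_filter // (sorted_uniq ltn_trans ltnn).
  by rewrite count_rem mem_nth.
have cnt_c1 : count (ltn^~ c.+1) D' = r.
  rewrite -[RHS](count_lt_nth sD r_lt) count_filter; apply: eq_count => d /=.
  by rewrite ltnS [RHS]ltn_neqAle andbC.
rewrite !IHrs // cnt_c1 cntD' nth_lt_count //.
by case: ltnP => _; rewrite ?subn1 ?subn0.
Qed.

Local Open Scope classical_set_scope.
Local Open Scope ring_scope.

(** * The law of the minimum of k uniform cards *)

Lemma count_ge_nth D r : sorted ltn D -> (r < size D)%N ->
  (count (leq (nth 0%N D r)) D = size D - r)%N /\
  (count (leq (nth 0%N D r).+1) D = size D - r.+1)%N.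
Proof.
elim: D r => [|d D IHD] // [|r] sD r_lt /=;
  have /allP dD := order_path_min ltn_trans sD.
  have all_ge : all (leq d.+1) D by apply/allP => e /dD.
  have all_ge' : all (leq d) D by apply: sub_all all_ge => e /ltnW.
  rewrite leqnn ltnn subn0 subn1 /= add0n.
  by split; [rewrite (eqP (_ : count (leq d) D == size D)) -?all_count|
             apply/eqP; rewrite -all_count].
have [-> ->] := IHD r (path_sorted sD) r_lt.
have d_lt : (d < nth 0 D r)%N by rewrite dD // mem_nth.
by rewrite leqNgt d_lt ltnNge ltnW.
Qed.

(** P(min = r) for k independent uniform elements of {0, ..., m - 1}, as the
    difference of the tails P(min >= r) and P(min > r). *)
Definition min_pmf (R : realType) (k m r : nat) : R :=
  ((m - r)%:R ^+ k - (m - r.+1)%:R ^+ k) / m%:R ^+ k.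

(** Expectation over the codes whose digits are independent, the digit drawn
    when m cards remain having law [min_pmf R k m]. *)
Fixpoint code_expect (R : realType) (k m : nat) (F : seq nat -> R) : R :=
  if m is m'.+1 then
    \sum_(r < m) min_pmf R k m r *
      code_expect k m' (fun rs => F (val r :: rs))
  else F [::].

Definition hand_min n k (x : {ffun 'I_k -> 'I_n}) : nat :=
  \big[minn/n]_(j < k) val (x j).

Definition hand_weight (R : realType) n k (D : seq nat)
    (x : {ffun 'I_k -> 'I_n}) : R :=
  \prod_(j < k) (if val (x j) \in D then (size D)%:R^-1 else 0).

Definition remaining (n : nat) (h : seq nat) : seq nat :=
  [seq c <- iota 0 n | c \notin h].

Lemma mem_remaining n h c : (c \in remaining n h) = (c < n)%N && (c \notin h).
Proof. by rewrite mem_filter mem_iota andbC. Qed.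

Lemma remaining_sorted n h : sorted ltn (remaining n h).
Proof. exact: sorted_filter ltn_trans _ _ (iota_ltn_sorted _ _). Qed.

(** The minimum is at least v when each of the k independent cards is, so the
    sum over hands factors into k identical sums over one card. *)
Lemma hand_min_survival (R : realType) n k h v (D := remaining n h) :
  (v <= n)%N ->
  \sum_(x : {ffun 'I_k -> 'I_n}) hand_weight R D x * (v <= hand_min x)%N%:R
  = ((count (leq v) D)%:R / (size D)%:R) ^+ k.
Proof.
move=> v_le_n.
have one_card : \sum_(c < n) (if val c \in D then (size D)%:R^-1 else 0) *
    (v <= c)%N%:R = (count (leq v) D)%:R / (size D)%:R :> R.
  rewrite -(big_mkord xpredT (fun c => (if c \in D then (size D)%:R^-1 else 0) *
    (v <= c)%N%:R)) /index_iota subn0.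
  rewrite -sum1_count natr_sum mulr_suml [RHS]big_filter_cond [RHS]big_mkcond.
  apply: eq_big_seq => c; rewrite mem_iota => /andP[_ c_lt] /=.
  rewrite mem_remaining c_lt /=.
  by case: (c \in h); case: leqP; rewrite ?mulr1 ?mulr0 ?mul1r ?mul0r.
rewrite -one_card -[in RHS](card_ord k) -prodr_const bigA_distr_bigA /=.
apply: eq_bigr => x _; rewrite big_split /=; congr (_ * _).
have andR : {morph (fun b : bool => b%:R : R) : a b / a && b >-> a * b}.
  by move=> a b; rewrite -natrM mulnb.
rewrite /hand_min (big_morph _ (leq_min v) (_ : leq v n = true)) //.
exact: (big_morph _ andR).
Qed.

Lemma hand_min_mem (R : realType) n k D (x : {ffun 'I_k -> 'I_n}) :
  (0 < k)%N -> hand_weight R D x != 0 -> hand_min x \in D.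
Proof.
move=> k_gt0 /prodf_neq0 w_neq0.
have xD j : val (x j) \in D by have := w_neq0 j isT; case: ifP; rewrite ?eqxx.
have : hand_min x = n \/ exists j, hand_min x = x j.
  rewrite /hand_min; elim/big_ind: _ => [|a b IHa IHb|j _]; first by left.
    by case: (leqP a b).
  by right; exists j.
case=> [min_n|[j ->]]; last exact: xD.
have : (n <= hand_min x)%N by rewrite min_n.
rewrite /hand_min (big_morph _ (leq_min n) (leqnn n)) big_andE.
by move=> /forallP/(_ (Ordinal k_gt0)); rewrite leqNgt ltn_ord.
Qed.

(** Integrating out the hand leaves the rank of its minimum among the remaining
    cards, whose law depends on their number only.  This is the source of the
    independence of the ranks. *)
Lemma hand_min_law (R : realType) n k h (G : nat -> R)
    (D := remaining n h) : (0 < k)%N ->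
  \sum_(x : {ffun 'I_k -> 'I_n}) hand_weight R D x * G (hand_min x)
  = \sum_(r < size D) min_pmf R k (size D) r * G (nth 0%N D r).
Proof.
move=> k_gt0; have D_sorted : sorted ltn D := remaining_sorted n h.
(* The indicator of min x = v as a difference of two tails. *)
pose hit v (x : {ffun 'I_k -> 'I_n}) : R :=
  (v <= hand_min x)%N%:R - (v.+1 <= hand_min x)%N%:R.
transitivity (\sum_(x : {ffun 'I_k -> 'I_n}) \sum_(r < size D)
    G (nth 0%N D r) * (hand_weight R D x * hit (nth 0%N D r) x)).
  apply: eq_bigr => x _.
  have [->|w_neq0] := eqVneq (hand_weight R D x) 0.
    by rewrite mul0r big1 // => r _; rewrite mul0r mulr0.
  have xD := hand_min_mem k_gt0 w_neq0.
  have i_lt : (index (hand_min x) D < size D)%N by rewrite index_mem.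
  rewrite (bigD1 (Ordinal i_lt)) //= nth_index // big1 ?addr0 => [|r].
    by rewrite /hit leqnn ltnn subr0 mulr1 mulrC.
  rewrite -val_eqE /= => r_neq.
  have : nth 0%N D r != hand_min x.
    apply: contra r_neq => /eqP <-.
    by rewrite index_uniq ?(sorted_uniq ltn_trans ltnn).
  by rewrite /hit leq_eqVlt => /negbTE ->; rewrite subrr !mulr0.
rewrite exchange_big; apply: eq_bigr => r _.
rewrite -mulr_sumr mulrC; congr (_ * _); rewrite /hit /min_pmf.
under eq_bigr do rewrite mulrBr.
have : nth 0%N D r \in D by rewrite mem_nth.
rewrite mem_remaining => /andP[lt_n _].
rewrite big_split /= sumrN !hand_min_survival ?(ltnW lt_n) //.
have [-> ->] := count_ge_nth D_sorted (ltn_ord r).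
by rewrite !expr_div_n -mulrBl.
Qed.

(** * Independence of the code *)

Lemma eq_code_expect (R : realType) k m (F G : seq nat -> R) :
  (forall rs, is_code m rs -> F rs = G rs) ->
  code_expect k m F = code_expect k m G.
Proof.
elim: m F G => [|m IHm] F G eqFG /=; first exact: eqFG.
apply: eq_bigr => r _; congr (_ * _); apply: IHm => rs code_rs.
by apply: eqFG; rewrite /= ltn_ord.
Qed.

(** The chain rule read forwards: the weight of drawing the hands u when the
    cards in h have already been selected. *)
Fixpoint path_weight (R : realType) n k (h : seq nat)
    (u : seq {ffun 'I_k -> 'I_n}) : R :=
  if u is x :: u' then
    hand_weight R (remaining n h) x * path_weight R (rcons h (hand_min x)) u'
  else 1.

Lemma path_weightE (R : realType) n k h (u : seq {ffun 'I_k -> 'I_n}) x0 :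
  path_weight R h u = \prod_(i < size u)
    hand_weight R (remaining n (h ++ map (@hand_min n k) (take i u)))
      (nth x0 u i).
Proof.
elim: u h => [|x u IHu] h; first by rewrite big_ord0.
rewrite /= big_ord_recl /= cats0 IHu; congr (_ * _).
by apply: eq_bigr => i _; rewrite cat_rcons.
Qed.

Lemma kCM_weight_path (R : realType) n k (w : samples n k) :
  kCM_weight R w = path_weight R [::] [seq w t | t <- enum 'I_n].
Proof.
have [n0|n_gt0] := posnP n.
  by subst n; rewrite /kCM_weight big_ord0 (size0nil (size_enum_ord 0)).
have t0 : 'I_n := Ordinal n_gt0.
rewrite (path_weightE _ _ _ (w t0)) size_map size_enum_ord.
apply: eq_bigr => t _; rewrite (nth_map t0) ?size_enum_ord // nth_ord_enum.
set h := _ ++ _.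
have hE : h = [seq selected w s | s <- take t (enum 'I_n)].
  by rewrite /h -map_take -map_comp.
have mem_take s : (s \in take t (enum 'I_n)) = (s < t)%N.
  by rewrite in_take ?mem_enum // index_enum_ord.
have mem_h (c : 'I_n) : (c \in available w t) = (val c \notin h).
  rewrite inE hE; apply/forallP/negP => [sel /mapP[s]|c_notin s].
    by rewrite mem_take => s_lt cE; have := sel s; rewrite s_lt cE eqxx.
  apply/implyP => s_lt; apply/eqP => cE; apply: c_notin.
  by apply/mapP; exists s; rewrite ?mem_take.
have card_h : #|available w t| = size (remaining n h).
  rewrite -sum1_card (eq_bigl _ _ mem_h) size_filter -sum1_count.
  by rewrite -(big_mkord (fun c => c \notin h) (fun=> 1%N)) /index_iota subn0.
by apply: eq_bigr => j _; rewrite mem_h mem_remaining ltn_ord card_h.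
Qed.

Lemma sum_tuple_recl (R : realType) (T : finType) m (f : seq T -> R) :
  \sum_(u : m.+1.-tuple T) f u = \sum_(x : T) \sum_(u : m.-tuple T) f (x :: u).
Proof.
rewrite pair_big /=.
rewrite (reindex (fun p : T * m.-tuple T => cons_tuple p.1 p.2)) //=.
exists (fun u => (thead u, behead_tuple u)) => [[x u] _|u _] /=.
  by rewrite theadE; congr pair; exact: val_inj.
by rewrite [RHS]tuple_eta; exact: val_inj.
Qed.

(** Summing over the first hand by [hand_min_law] and over the others by
    induction replaces hands by ranks one step at a time. *)
Lemma sum_path_weight (R : realType) n k m h (F : seq nat -> R) :
  (0 < k)%N -> size (remaining n h) = m ->
  \sum_(u : m.-tuple {ffun 'I_k -> 'I_n})
     path_weight R h u * F (map (@hand_min n k) u)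
  = code_expect k m (fun rs => F (cards_of_code (remaining n h) rs)).
Proof.
move=> k_gt0; elim: m h F => [|m IHm] h F szD.
  rewrite (eq_bigr (fun=> F [::])) => [|u _]; last by rewrite tuple0 /= mul1r.
  by rewrite sumr_const card_tuple expn0.
have remaining_rcons c :
    remaining n (rcons h c) = [seq d <- remaining n h | d != c].
  rewrite -filter_predI; apply: eq_filter => d /=.
  by rewrite mem_rcons inE negb_or.
rewrite (sum_tuple_recl _ (fun u => path_weight R h u * F (map _ u))).
pose G c := code_expect k m (fun rs =>
  F (c :: cards_of_code (remaining n (rcons h c)) rs)).
transitivity (\sum_(x : {ffun 'I_k -> 'I_n})
    hand_weight R (remaining n h) x * G (hand_min x)).
  apply: eq_bigr => x _ /=.
  under eq_bigr do rewrite -mulrA; rewrite -mulr_sumr.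
  (* A hand of positive weight has its minimum among the remaining cards, so
     that exactly one card leaves. *)
  have [->|w_neq0] := eqVneq (hand_weight R (remaining n h) x) 0.
    by rewrite !mul0r.
  congr (_ * _); rewrite (IHm _ (fun s => F (hand_min x :: s))) //.
  have x_in := hand_min_mem k_gt0 w_neq0.
  rewrite remaining_rcons -(nth_index 0%N x_in).
  by rewrite size_filter_neq_nth ?remaining_sorted ?index_mem // szD.
rewrite hand_min_law // szD; apply: eq_bigr => r _; congr (_ * _).
by apply: eq_code_expect => rs _ /=; rewrite remaining_rcons.
Qed.

(** The ranks of the selected cards are independent, [cards_of_code] recovers
    the cards from their ranks, and the length depends on the ranks only. *)
Lemma kCM_expect_L (R : realType) n k (phi : nat -> R) : (0 < k)%N ->
  kCM_expect (fun w : samples n k => phi (kCM_L w))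
  = code_expect k n (fun rs => phi (code_lis 0 rs)).
Proof.
move=> k_gt0.
have D0 : remaining n [::] = iota 0 n by exact: filter_predT.
transitivity (code_expect k n (fun rs =>
    phi (lis_above 0 (cards_of_code (remaining n [::]) rs)))); last first.
  apply: eq_code_expect => rs code_rs; congr phi.
  rewrite lis_above_cards_of_code ?remaining_sorted //.
    by rewrite (eq_count (_ : _ =1 pred0)) ?count_pred0.
  by rewrite D0 size_iota.
rewrite -(sum_path_weight (fun s => phi (lis_above 0 s))) //; last first.
  by rewrite D0 size_iota.
rewrite /kCM_expect (reindex (fun u : n.-tuple {ffun 'I_k -> 'I_n} =>
  [ffun t => tnth u t] : samples n k)) /=; last first.
  exists (fun w : samples n k => [tuple w t | t < n]) => [u _|w _].
    by apply: eq_from_tnth => t; rewrite tnth_mktuple ffunE.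
  by apply/ffunP => t; rewrite ffunE tnth_mktuple.
apply: eq_bigr => u _; set w := [ffun t => _].
have uE : [seq w t | t <- enum 'I_n] = u.
  rewrite -[RHS]map_tnth_enum; apply: eq_map => t; exact: ffunE.
rewrite kCM_weight_path uE; congr (_ * phi _).
by rewrite /kCM_L lis_eq_lis_above -uE -map_comp.
Qed.

(** * Expectations over independent codes *)

Lemma sum_telescope_from (R : realType) m rho (f : nat -> R) : (rho <= m)%N ->
  \sum_(r < m) (f r - f r.+1) * (rho <= r)%N%:R = f rho - f m.
Proof.
move=> rho_le.
rewrite (eq_bigr (fun r : 'I_m => if (rho <= r)%N then f r - f r.+1 else 0)).
  rewrite -big_mkcond /=.
  rewrite -(big_mkord (fun r => rho <= r)%N (fun r => f r - f r.+1)).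
  rewrite (big_cat_nat _ rho_le) //= big_nat_cond big_pred0 ?add0r => [|r].
    rewrite -[RHS]opprB -(telescope_sumr f rho_le) -sumrN.
    rewrite big_nat_cond [RHS]big_nat_cond.
    apply: eq_big => [r|r _]; last by rewrite opprB.
    by case: (leqP rho r); rewrite ?andbF ?andbT.
  by case: leqP; rewrite ?andbF ?andbT // => /ltn_geF ->.
by move=> r _; case: ifP; rewrite ?mulr1 ?mulr0.
Qed.

Lemma min_pmf_ge0 (R : realType) k m r : 0 <= min_pmf R k m r.
Proof.
rewrite divr_ge0 ?exprn_ge0 // subr_ge0 lerXn2r ?nnegrE // ler_nat.
exact: leq_sub2l.
Qed.

Lemma min_pmf_tail (R : realType) k m rho : (0 < k)%N -> (0 < m)%N ->
  \sum_(r < m) min_pmf R k m r * (rho <= r)%N%:R = ((m - rho)%:R / m%:R) ^+ k.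
Proof.
move=> k_gt0 m_gt0; have [rho_le|m_lt] := leqP rho m; last first.
  rewrite big1 => [|r _]; first last.
    by rewrite leqNgt (ltn_trans (ltn_ord r) m_lt) mulr0.
  by rewrite (eqP (ltnW m_lt : (_ <= _)%N)) mul0r expr0n gtn_eqF.
pose f r : R := (m - r)%:R ^+ k / m%:R ^+ k.
rewrite (eq_bigr (fun r : 'I_m => (f r - f r.+1) * (rho <= r)%N%:R)) => [|r _].
  rewrite sum_telescope_from // /f subnn expr0n gtn_eqF // mul0r subr0.
  by rewrite expr_div_n.
by rewrite -mulrBl.
Qed.

Lemma sum_min_pmf (R : realType) k m : (0 < k)%N -> (0 < m)%N ->
  \sum_(r < m) min_pmf R k m r = 1.
Proof.
move=> k_gt0 m_gt0; have := min_pmf_tail R 0 k_gt0 m_gt0.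
under eq_bigr do rewrite mulr1.
by rewrite subn0 divff ?expr1n // pnatr_eq0 -lt0n.
Qed.

(** Union bound over the k cards; algebraically, A ^ k - (A - 1) ^ k with A <= m
    factors into k terms, each at most m ^ (k - 1). *)
Lemma min_pmf_le (R : realType) k m r : (r < m)%N -> (0 < k)%N ->
  min_pmf R k m r <= k%:R / m%:R.
Proof.
move=> r_lt k_gt0.
have m_gt0 : 0 < m%:R :> R by rewrite ltr0n (leq_trans _ r_lt).
rewrite /min_pmf subrXX -natrB ?leq_sub2l //.
have -> : (m - r - (m - r.+1) = 1)%N by lia.
rewrite mul1r ler_pdivrMr ?exprn_gt0 //.
have -> : k%:R / m%:R * m%:R ^+ k = \sum_(i < k) m%:R ^+ k.-1 :> R.
  rewrite sumr_const card_ord -mulr_natl -{2}(prednK k_gt0) exprS.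
  by field; rewrite gt_eqF.
apply: ler_sum => i _.
have i_le : (i <= k.-1)%N by rewrite -ltnS prednK.
rewrite -[X in _ <= _ ^+ X](subnK i_le) exprD.
by rewrite ler_pM ?exprn_ge0 // lerXn2r ?nnegrE // ler_nat leq_subr.
Qed.

Lemma le_code_expect (R : realType) k m (F G : seq nat -> R) :
  (forall rs, F rs <= G rs) -> code_expect k m F <= code_expect k m G.
Proof.
elim: m F G => [|m IHm] F G leFG /=; first exact: leFG.
by apply: ler_sum => r _; rewrite ler_wpM2l ?min_pmf_ge0 // IHm.
Qed.

Lemma code_expectD (R : realType) k m (F G : seq nat -> R) :
  code_expect k m (fun rs => F rs + G rs)
  = code_expect k m F + code_expect k m G.
Proof.
elim: m F G => [|m IHm] F G //=.
rewrite -big_split /=; apply: eq_bigr => r _.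
rewrite -mulrDr.
by rewrite (IHm (fun rs => F (val r :: rs)) (fun rs => G (val r :: rs))).
Qed.

Lemma code_expectZ (R : realType) k m (c : R) (F : seq nat -> R) :
  code_expect k m (fun rs => c * F rs) = c * code_expect k m F.
Proof.
elim: m F => [|m IHm] F //=.
rewrite mulr_sumr; apply: eq_bigr => r _.
by rewrite (IHm (fun rs => F (val r :: rs))) mulrCA.
Qed.

Lemma code_expect1 (R : realType) k m : (0 < k)%N ->
  code_expect k m (fun=> 1) = 1 :> R.
Proof.
move=> k_gt0; elim: m => [|m IHm] //=.
by under eq_bigr do rewrite IHm mulr1; exact: sum_min_pmf.
Qed.

Lemma code_expect_ge0 (R : realType) k m (F : seq nat -> R) :
  (forall rs, 0 <= F rs) -> 0 <= code_expect k m F.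
Proof.
elim: m F => [|m IHm] F F_ge0 /=; first exact: F_ge0.
by apply: sumr_ge0 => r _; rewrite mulr_ge0 ?min_pmf_ge0 // IHm.
Qed.

(** Raising the threshold leaves fewer cards to choose from. *)
Lemma code_lis_anti rho rho' rs : (rho <= rho')%N ->
  (code_lis rho' rs <= code_lis rho rs)%N.
Proof.
elim: rs rho rho' => //= r rs IHrs rho rho' le_rho.
case: (ltnP r rho') => [r_lt'|r_ge']; last first.
  rewrite ltnNge (leq_trans le_rho r_ge') /= geq_max leq_maxl /=.
  by rewrite leq_max IHrs ?orbT.
case: (ltnP r rho) => [r_lt|r_ge]; first by apply: IHrs; lia.
by rewrite leq_max IHrs ?orbT //; lia.
Qed.

(** * Upper bound on the exponential moment *)

(** The weighted count of increasing subsequences among the next T draws and the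
    m0 + T - rho cards above the threshold, times a bound V for what the last m0
    draws contribute.  At the first draw the maximum is bounded by a sum: either
    the card is left out, which costs a factor 1, or it is taken, with weight X.
    Over the possible ranks of a card that is taken, the powers of 1 + b form a
    geometric series, and the condition on a * b bounds their contribution by
    the fraction a of the previous bound. *)
Lemma code_expect_block (R : realType) k m0 T rho (X V a b : R) :
  (0 < k)%N -> 1 <= X -> 0 <= a -> 0 < b ->
  X * k%:R <= a * b * m0.+1%:R ->
  code_expect k m0 (fun rs => X ^+ code_lis 0 rs) <= V ->
  (rho <= m0 + T)%N ->
  code_expect k (m0 + T) (fun rs => X ^+ code_lis rho rs)
    <= V * (1 + a) ^+ T * (1 + b) ^+ (m0 + T - rho).
Proof.
move=> k_gt0 X_ge1 a_ge0 b_gt0 Xk V_ge.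
have V_ge0 : 0 <= V.
  apply: le_trans V_ge; apply: code_expect_ge0 => rs.
  by rewrite exprn_ge0 // (le_trans _ X_ge1).
have X_ge0 : 0 <= X by lra.
have b1 : 1 <= 1 + b by lra.
elim: T rho => [|T IHT] rho.
  rewrite addn0 expr0 mulr1 => rho_le.
  apply: (@le_trans _ _ V); last by rewrite ler_peMr // exprn_ege1.
  apply: le_trans V_ge; apply: le_code_expect => rs.
  by rewrite ler_weXn2l // code_lis_anti.
rewrite addnS => rho_le /=; set m := (m0 + T)%N in IHT rho_le *.
set C := V * (1 + a) ^+ T in IHT *.
have C_ge0 : 0 <= C by rewrite mulr_ge0 // exprn_ge0 // addr_ge0.
set B := (1 + b) ^+ (m.+1 - rho).
have B_ge1 : 1 <= B by rewrite exprn_ege1.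
have first_card (r : 'I_m.+1) :
  code_expect k m (fun rs => X ^+ code_lis rho (val r :: rs)) <=
    C * B + C * (X * ((1 + b) ^+ (m - r) * (rho <= r)%N%:R)).
  case: (ltnP r rho) => [r_lt|r_ge]; rewrite /= ?r_lt.
    have rho_gt0 : (0 < rho)%N := leq_ltn_trans (leq0n r) r_lt.
    rewrite !mulr0 addr0; apply: le_trans (IHT _ _) _.
      by rewrite -ltnS prednK.
    by rewrite -subSS prednK.
  rewrite ltnNge r_ge /= mulr1 addrC.
  apply: (@le_trans _ _ (code_expect k m (fun rs =>
      X * X ^+ code_lis r rs + X ^+ code_lis rho rs))).
    apply: le_code_expect => rs; rewrite -exprS.
    by case: leqP => _; rewrite ?lerDr ?lerDl exprn_ge0.
  rewrite (code_expectD k m (fun rs => X * X ^+ code_lis r rs)) code_expectZ.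
  rewrite lerD //.
    by rewrite mulrCA ler_wpM2l // IHT // -ltnS.
  apply: le_trans (IHT _ _) _; first exact: leq_trans r_ge (ltnSE (ltn_ord r)).
  by rewrite ler_wpM2l // ler_weXn2l // leq_sub2r.
apply: (@le_trans _ _ (\sum_(r < m.+1) (min_pmf R k m.+1 r * (C * B) +
    C * (X * (k%:R / m.+1%:R)) * ((1 + b) ^+ (m - r) * (rho <= r)%N%:R)))).
  apply: ler_sum => r _.
  apply: le_trans (ler_wpM2l (min_pmf_ge0 R k m.+1 r) (first_card r)) _.
  rewrite mulrDr lerD //; set G := (1 + b) ^+ _ * _.
  have G_ge0 : 0 <= G by rewrite mulr_ge0 ?exprn_ge0 ?(le_trans _ b1).
  have -> : min_pmf R k m.+1 r * (C * (X * G)) = C * X * G * min_pmf R k m.+1 r.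
    by ring.
  have := min_pmf_le R (ltn_ord r) k_gt0; set q := k%:R / m.+1%:R => p_le_q.
  have -> : C * (X * q) * G = C * X * G * q by ring.
  apply: ler_wpM2l p_le_q; exact: mulr_ge0 (mulr_ge0 C_ge0 X_ge0) G_ge0.
rewrite big_split /= -mulr_suml sum_min_pmf // mul1r -mulr_sumr.
set S := \sum_(r < m.+1) _.
(* The geometric sum, as a telescoping one. *)
have bS : b * S = B - 1.
  rewrite /B -[1 in RHS](expr0 (1 + b)) -[X in _ - _ ^+ X](subnn m.+1).
  rewrite -(sum_telescope_from (fun r => (1 + b) ^+ (m.+1 - r))) //.
  rewrite mulr_sumr; apply: eq_bigr => r _; rewrite mulrA; congr (_ * _).
  by rewrite subSS (subSn (ltnSE (ltn_ord r))) exprS; ring.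
have S_ge0 : 0 <= S.
  by apply: sumr_ge0 => r _; rewrite mulr_ge0 ?exprn_ge0 ?addr_ge0 ?(ltW b_gt0).
have XkS : X * (k%:R / m.+1%:R) * S <= a * B.
  apply: (@le_trans _ _ (a * b * S)).
    rewrite ler_wpM2r // mulrA ler_pdivrMr ?ltr0n //.
    apply: le_trans Xk _; rewrite ler_wpM2l ?mulr_ge0 ?(ltW b_gt0) //.
    by rewrite ler_nat ltnS leq_addr.
  by rewrite -mulrA bS ler_wpM2l // gerBl.
have -> : V * (1 + a) ^+ T.+1 * B = C * (B + a * B) by rewrite /C exprSr; ring.
rewrite -[C * (X * _) * S]mulrA -mulrDr; apply: ler_wpM2l C_ge0 _ _ _.
by rewrite lerD2l.
Qed.

Lemma exprD1_le_expR (R : realType) (x : R) n : 0 <= x ->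
  (1 + x) ^+ n <= expR (x * n%:R).
Proof.
move=> x_ge0; rewrite expRM_natr lerXn2r ?nnegrE ?expR_ge0 ?addr_ge0 //.
exact: expR_ge1Dx.
Qed.

(** Halving induction: one block down to m0 = m / 2 cards, then the same
    procedure on m0 cards. *)
Lemma code_expect_expR_le (R : realType) k m : (0 < k)%N ->
  code_expect k m (fun rs => expR 2 ^+ code_lis 0 rs)
    <= expR (8 * expR 1 * Num.sqrt (k * m)%:R) :> R.
Proof.
move=> k_gt0; elim/ltn_ind: m => m IHm.
have [->|m_gt0] := posnP m; first by rewrite muln0 sqrtr0 mulr0 expR0 /= expr0.
have half_lt : (m./2 < m)%N.
  by rewrite ltn_half_double -addnn -[X in (X < _)%N]addn0 ltn_add2l.
set m0 := m./2 in half_lt *; set T := (m - m0)%N.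
have m_split : m = (m0 + T)%N by rewrite subnKC // ltnW.
set e : R := expR 1; set s := Num.sqrt (k * m)%:R : R.
have e_gt0 : 0 < e by exact: expR_gt0.
have mR_gt0 : 0 < m%:R :> R by rewrite ltr0n.
have s2 : s * s = k%:R * m%:R by rewrite -expr2 sqr_sqrtr ?natrM.
have s_gt0 : 0 < s by rewrite sqrtr_gt0 ltr0n muln_gt0 k_gt0.
(* The balanced choice: both a * T and b * m are at most e * sqrt (k m). *)
pose a := e * s / m0.+1%:R; pose b := e * s / m%:R.
have a_ge0 : 0 <= a by rewrite divr_ge0 // mulr_ge0 // ltW.
have b_gt0 : 0 < b by rewrite divr_gt0 // mulr_gt0.
have Xk : expR 2 * k%:R <= a * b * m0.+1%:R.
  have -> : expR 2 = e * e :> R by rewrite -expRD.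
  have -> : a * b * m0.+1%:R = e * e * (s * s) / m%:R.
    by rewrite /a /b; field; rewrite !gt_eqF // ltr0n.
  by rewrite s2 -!mulrA mulfV ?gt_eqF // mulr1.
have X_ge1 : 1 <= expR 2 :> R by rewrite -expR0 ler_expR.
have := code_expect_block (T := T) (rho := 0) k_gt0 X_ge1 a_ge0 b_gt0 Xk
  (IHm _ half_lt) (leq0n _).
rewrite -m_split subn0 => /le_trans; apply.
have T_le : T%:R <= m0.+1%:R :> R.
  rewrite ler_nat leq_subLR addnS addnn -[X in (X <= _)%N]odd_double_half.
  by rewrite -/m0; case: odd.
have aT : a * T%:R <= e * s.
  rewrite /a mulrAC ler_pdivrMr ?ltr0n // ler_wpM2l //.
  by rewrite mulr_ge0 // ltW.
have bm : b * m%:R = e * s by rewrite /b mulfVK // gt_eqF.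
have s0_le : Num.sqrt (k * m0)%:R <= 3 / 4 * s.
  have rhs_ge0 : 0 <= 3 / 4 * s by lra.
  rewrite -(@ler_pXn2r _ 2) ?nnegrE ?sqrtr_ge0 //.
  rewrite sqr_sqrtr // exprMn expr2 [s ^+ 2]expr2 s2 natrM.
  have m0_le : m0%:R <= m%:R / 2 :> R.
    by rewrite ler_pdivlMr // -natrM ler_nat muln2 -geq_half_double.
  have := ler_wpM2l (ler0n R k) m0_le.
  have : 0 <= k%:R * m%:R :> R by rewrite mulr_ge0.
  lra.
have exp_ge0 (x : R) := expR_ge0 x.
apply: (@le_trans _ _ (expR (8 * e * Num.sqrt (k * m0)%:R) *
   expR (e * s) * expR (e * s))).
  apply: ler_pM; rewrite ?mulr_ge0 ?exprn_ge0 ?addr_ge0 ?(ltW b_gt0) //.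
    apply: ler_wpM2l; rewrite // (le_trans (exprD1_le_expR _ _)) //.
    by rewrite ler_expR.
  by rewrite -bm exprD1_le_expR // ltW.
rewrite -!expRD ler_expR.
have := ler_wpM2l (ltW e_gt0) s0_le.
nra.
Qed.

(** * Lower bound on the exponential moment *)

(** The moment of the greedy subsequence that takes a card when its rank is in
    the window [rho, rho + g).  Let N be the number of cards taken and A the
    number of draws with r >= rho.  Given r >= rho the card is taken with
    probability at least p, so y ^ N * v ^- (A - N) has expectation at most 1;
    and A - N >= m - rho - g * N, because the m - A other draws lower rho by
    one each, taking a card raises it by at most g - 1, and rho is never
    negative.  The induction combines the two: drawing below the threshold
    decreases m and rho together and leaves the bound unchanged, taking a card
    costs w <= y * v ^ g, and missing the window costs v^-1.  The hypothesis on
    s - g says that P(r >= rho + g) <= (1 - p) * P(r >= rho). *)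
Lemma code_expect_greedy (R : realType) k n g m rho (w v y p : R) :
  (0 < k)%N -> 0 <= w <= 1 -> 0 < v <= 1 -> 0 <= y <= 1 ->
  w <= y * v ^+ g -> p * y + (1 - p) * v^-1 <= 1 ->
  (forall s, (s <= n)%N -> (s - g)%:R ^+ k <= (1 - p) * s%:R ^+ k) ->
  (rho <= m)%N -> (m <= n)%N ->
  code_expect k m (fun rs => w ^+ code_lis rho rs) <= v ^+ (m - rho).
Proof.
move=> k_gt0 /andP[w_ge0 w_le1] /andP[v_gt0 v_le1] /andP[y_ge0 y_le1].
move=> w_le py gap; have v_ge0 := ltW v_gt0.
have vinv : 1 <= v^-1 by rewrite invf_ge1.
elim: m rho => [|m IHm] rho rho_le m_le.
  have -> : rho = 0%N by case: rho rho_le.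
  by rewrite /= expr0.
have {IHm} IHm rho' : (rho' <= m)%N -> _ := fun h => IHm rho' h (ltnW m_le).
set B := v ^+ (m.+1 - rho).
have B_ge0 : 0 <= B by rewrite exprn_ge0.
(* The bound after a first draw of rank r: 1 below the threshold, y in the
   window, v^-1 beyond it. *)
have first_card (r : 'I_m.+1) :
  code_expect k m (fun rs => w ^+ code_lis rho (val r :: rs)) <=
    B * (1 + (y - 1) * (rho <= r)%N%:R + (v^-1 - y) * (rho + g <= r)%N%:R).
  have r_le : (r <= m)%N := ltnSE (ltn_ord r).
  case: (ltnP r rho) => [r_lt|r_ge]; rewrite /= ?r_lt.
    have rho_gt0 : (0 < rho)%N := leq_ltn_trans (leq0n r) r_lt.
    rewrite [(rho + g <= r)%N]leqNgt ltn_addr // !mulr0 !addr0 mulr1.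
    apply: le_trans (IHm rho.-1 _) _; first by rewrite -ltnS prednK.
    by rewrite -subSS prednK.
  rewrite ltnNge r_ge /= mulr1; case: (leqP (rho + g) r) => [r_far|r_near].
    have -> : B * (1 + (y - 1) + (v^-1 - y) * 1) = v ^+ (m - rho).
      rewrite /B subSn ?(leq_trans r_ge) // exprS.
      by field; rewrite gt_eqF.
    apply: le_trans (IHm rho _); last exact: leq_trans r_ge _.
    by apply: le_code_expect => rs; rewrite ler_wiXn2l // leq_maxr.
  have -> : B * (1 + (y - 1) + (v^-1 - y) * 0) = y * B by ring.
  apply: (@le_trans _ _ (code_expect k m (fun rs => w * w ^+ code_lis r rs))).
    by apply: le_code_expect => rs; rewrite -exprS ler_wiXn2l // leq_maxl.
  rewrite code_expectZ; apply: le_trans (ler_wpM2l w_ge0 (IHm r r_le)) _.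
  apply: le_trans (ler_wpM2r (exprn_ge0 _ v_ge0) w_le) _.
  rewrite -mulrA ler_wpM2l // -exprD ler_wiXn2l // leq_subLR.
  by rewrite addnA -{1}(subnKC r_le) -addSn leq_add2r.
apply: (@le_trans _ _ (B * \sum_(r < m.+1) (min_pmf R k m.+1 r
    + (y - 1) * (min_pmf R k m.+1 r * (rho <= r)%N%:R)
    + (v^-1 - y) * (min_pmf R k m.+1 r * (rho + g <= r)%N%:R)))).
  rewrite mulr_sumr; apply: ler_sum => r _.
  apply: le_trans (ler_wpM2l (min_pmf_ge0 R k m.+1 r) (first_card r)) _.
  by rewrite le_eqVlt; apply/orP; left; apply/eqP; ring.
rewrite !big_split /= -!mulr_sumr sum_min_pmf // !min_pmf_tail //.
set Q := (_ / _) ^+ k; set Q' := (_ / _) ^+ k.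
have Q_ge0 : 0 <= Q by rewrite exprn_ge0.
have Q'_le : Q' <= (1 - p) * Q.
  rewrite /Q /Q' !expr_div_n mulrA ler_wpM2r ?invr_ge0 ?exprn_ge0 //.
  by rewrite subnDA gap // (leq_trans (leq_subr _ _)).
rewrite -[X in _ <= X]mulr1; apply: ler_wpM2l B_ge0 _ _ _.
have vy : 0 <= v^-1 - y by lra.
have := ler_wpM2l vy Q'_le.
have := ler_wpM2r Q_ge0 py.
nra.
Qed.

Lemma bernoulli (R : realType) (x : R) k : 0 <= x ->
  1 + k%:R * x <= (1 + x) ^+ k.
Proof.
move=> x_ge0; elim: k => [|k IHk]; first by rewrite mul0r addr0 expr0.
rewrite exprS; apply: le_trans (ler_wpM2l _ IHk); last by rewrite addr_ge0.
have : 0 <= k%:R * x by rewrite mulr_ge0.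
rewrite -natr1; nra.
Qed.

(** The greedy window g is the least integer above 1/x = sqrt(n/k), and
    p = x / (1 + x).  Then g * p <= 1, so that the exponent l + g * z per card
    taken is at most 2 l, while the exponent z gained per draw adds up to
    n * z = l S / ((1 + l)(1 + x)). *)
Lemma code_expect_expRN_le (R : realType) k n (l : R)
    (S := Num.sqrt (k * n)%:R) :
  (0 < k)%N -> (0 < n)%N -> 0 < l ->
  code_expect k n (fun rs => expR (- (2 * l)) ^+ code_lis 0 rs)
    <= expR (- (l * S / ((1 + l) * (1 + S / n%:R)))).
Proof.
move=> k_gt0 n_gt0 l_gt0.
have S_gt0 : 0 < S by rewrite sqrtr_gt0 ltr0n muln_gt0 k_gt0.
have nR_gt0 : 0 < n%:R :> R by rewrite ltr0n.
set x := S / n%:R; have x_gt0 : 0 < x by rewrite divr_gt0.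
have x2 : x * x * n%:R = k%:R.
  have S2 : S * S = k%:R * n%:R by rewrite -expr2 sqr_sqrtr ?natrM.
  have -> : x * x * n%:R = S * S / n%:R by rewrite /x; field; rewrite gt_eqF.
  by rewrite S2 mulfK // gt_eqF.
pose g := (Num.truncn x^-1).+1.
have /andP[g_le g_gt] : (g.-1%:R <= x^-1) && (x^-1 < g%:R).
  by apply: truncn_itv; rewrite invr_ge0 ltW.
have xg : 1 <= x * g%:R by rewrite -ler_pdivrMl // mulr1 ltW.
have xg' : x * g%:R <= 1 + x.
  by rewrite -natr1 mulrDr mulr1 lerD2r -ler_pdivlMl // mulr1.
pose p := x / (1 + x); pose u := l / (1 + l); pose z := p * u.
have frac01 (t : R) : 0 < t -> 0 < t / (1 + t) < 1.
  move=> t_gt0; have t1_gt0 : 0 < 1 + t by rewrite addr_gt0.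
  by rewrite divr_gt0 //= ltr_pdivrMr // mul1r ltrDr.
have p01 : 0 < p < 1 := frac01 x x_gt0.
have u01 : 0 < u < 1 := frac01 l l_gt0.
case/andP: p01 => p_gt0 p_lt1; case/andP: u01 => u_gt0 u_lt1.
have z_gt0 : 0 < z by rewrite mulr_gt0.
have z_lt1 : z < 1 by rewrite /z; nra.
have gz : g%:R * z <= l.
  have gp : g%:R * p <= 1.
    by rewrite /p mulrA ler_pdivrMr ?addr_gt0 // mul1r mulrC.
  have u_le : u <= l by rewrite /u ler_pdivrMr ?addr_gt0 //; nra.
  by rewrite /z mulrA; nra.
have -> : expR (- (l * S / ((1 + l) * (1 + x)))) = expR (- z) ^+ (n - 0).
  rewrite subn0 -expRM_natl; congr expR.
  have -> : S = x * n%:R by rewrite /x mulfVK // gt_eqF.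
  by rewrite /z /p /u; field; rewrite !gt_eqF // addr_gt0.
have exp01 (t : R) : 0 <= t -> 0 <= expR (- t) <= 1.
  by move=> t_ge0; rewrite expR_ge0 -expR0 ler_expR oppr_le0.
apply: (code_expect_greedy (n := n) (g := g) (y := expR (- l)) (p := p)) => //.
- by rewrite exp01 // mulr_ge0 // ltW.
- by rewrite expR_gt0; case/andP: (exp01 z (ltW z_gt0)).
- by rewrite exp01 // ltW.
- by rewrite -expRM_natl -expRD ler_expR; lra.
  (* Since y <= 1 - u and v^-1 <= 1 / (1 - p u), the claim reduces to
     p (1 - u) (1 - p u) <= p (1 - u). *)
- have y_le : expR (- l) <= 1 - u.
    have -> : 1 - u = (1 + l)^-1 by rewrite /u; field; rewrite gt_eqF ?addr_gt0.
    by rewrite expRN lef_pV2 ?posrE ?expR_gt0 ?addr_gt0 // expR_ge1Dx.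
  have v_le : (expR (- z))^-1 <= (1 - z)^-1.
    rewrite lef_pV2 ?posrE ?expR_gt0 ?subr_gt0 //; exact: expR_ge1Dx.
  apply: (@le_trans _ _ (p * (1 - u) + (1 - p) * (1 - z)^-1)).
    by rewrite lerD // ler_wpM2l ?subr_ge0 // ltW.
  rewrite -lerBrDl ler_pdivrMr ?subr_gt0 // /z; nra.
  (* With h = g / s the claim reads (1 - h) ^ k <= 1 / (1 + x); it follows from
     (1 - h) (1 + h) <= 1 and (1 + h) ^ k >= 1 + k h >= 1 + k g / n >= 1 + x. *)
- move=> s s_le; have [s_le_g|g_lt_s] := leqP s g.
    rewrite (eqP (s_le_g : (_ <= _)%N)) expr0n gtn_eqF //.
    by rewrite mulr_ge0 ?subr_ge0 ?exprn_ge0 // ltW.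
  have sR_gt0 : 0 < s%:R :> R by rewrite ltr0n (leq_trans _ g_lt_s).
  have s_leR : s%:R <= n%:R :> R by rewrite ler_nat.
  have -> : 1 - p = (1 + x)^-1 by rewrite /p; field; rewrite gt_eqF ?addr_gt0.
  rewrite ler_pdivlMl ?addr_gt0 // natrB ?(ltnW g_lt_s) //.
  have d_ge0 : 0 <= s%:R - g%:R :> R by rewrite subr_ge0 ler_nat ltnW.
  have q_ge0 : 0 <= g%:R / s%:R :> R by rewrite divr_ge0.
  apply: (@le_trans _ _ ((1 + g%:R / s%:R) ^+ k * (s%:R - g%:R) ^+ k)).
    rewrite ler_wpM2r ?exprn_ge0 //; apply: le_trans (bernoulli k q_ge0).
    rewrite lerD2l mulrA ler_pdivlMr // -x2.
    have : x * s%:R <= x * n%:R by rewrite ler_pM2l.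
    have : 0 <= x * n%:R by rewrite mulr_ge0 // ltW.
    nra.
  rewrite -exprMn; apply: lerXn2r; rewrite ?nnegrE ?(ltW sR_gt0) //.
    by apply: mulr_ge0 => //; apply: addr_ge0.
  have -> : (1 + g%:R / s%:R) * (s%:R - g%:R)
    = s%:R - g%:R * g%:R / s%:R :> R by field; rewrite gt_eqF.
  by rewrite gerBl !mulr_ge0 // invr_ge0.
Qed.

(** * Consequences of exponential moments *)

Lemma kCM_weight_ge0 (R : realType) n k (w : samples n k) :
  0 <= kCM_weight R w.
Proof.
by do 2!apply: prodr_ge0 => ? _; case: ifP; rewrite ?invr_ge0 ?ler0n.
Qed.

Lemma kCM_weight_sum (R : realType) n k : (0 < k)%N ->
  \sum_(w : samples n k) kCM_weight R w = 1.
Proof.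
move=> k_gt0; rewrite -(code_expect1 R n k_gt0) -(kCM_expect_L _ (fun=> 1)) //.
by apply: eq_bigr => w _; rewrite mulr1.
Qed.

(** Jensen's inequality for the exponential, from expR y >= 1 + y at
    y = c * X - M. *)
Lemma kCM_jensen (R : realType) n k (X : samples n k -> R) (c M : R) :
  (0 < k)%N -> kCM_expect (fun w => expR (c * X w)) <= expR M ->
  c * kCM_expect X <= M.
Proof.
move=> k_gt0; rewrite -(mulr1 (expR M)) -ler_pdivrMl ?expR_gt0 // -expRN => le1.
have : kCM_expect (fun w => 1 + (- M + c * X w)) <= 1.
  apply: le_trans le1; rewrite /kCM_expect mulr_sumr; apply: ler_sum => w _.
  by rewrite mulrCA ler_wpM2l ?kCM_weight_ge0 // -expRD expR_ge1Dx.
have -> : kCM_expect (fun w => 1 + (- M + c * X w)) = 1 - M + c * kCM_expect X.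
  transitivity (\sum_w (kCM_weight R w * (1 - M) + c * (kCM_weight R w * X w))).
    by apply: eq_bigr => w _; ring.
  by rewrite big_split /= -mulr_suml -mulr_sumr kCM_weight_sum // mul1r.
lra.
Qed.

Lemma kCM_markov (R : realType) n k (X : samples n k -> R)
    (A : pred (samples n k)) (c M t : R) :
  kCM_expect (fun w => expR (c * X w)) <= expR M ->
  (forall w, A w -> t <= c * X w) -> kCM_prob R A <= expR (M - t).
Proof.
move=> le_M A_t; rewrite expRD expRN ler_pdivlMr ?expR_gt0 //.
apply: le_trans le_M; rewrite mulr_suml big_mkcond; apply: ler_sum => w _.
case: ifP => [/A_t t_le|_].
  by rewrite ler_wpM2l ?kCM_weight_ge0 // ler_expR.
by rewrite mulr_ge0 ?kCM_weight_ge0 // expR_ge0.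
Qed.

Lemma kCM_prob_le1 (R : realType) n k (A : pred (samples n k)) : (0 < k)%N ->
  kCM_prob R A <= 1.
Proof.
move=> k_gt0; rewrite -(kCM_weight_sum R n k_gt0) /kCM_prob big_mkcond.
by apply: ler_sum => w _; case: ifP => // _; exact: kCM_weight_ge0.
Qed.

Lemma kCM_prob_cover (R : realType) n k (A B C : pred (samples n k)) :
  (0 < k)%N -> (forall w, [|| A w, B w | C w]) ->
  1 <= kCM_prob R A + kCM_prob R B + kCM_prob R C.
Proof.
move=> k_gt0 cover; rewrite -(kCM_weight_sum R n k_gt0) /kCM_prob.
rewrite (big_mkcond A) (big_mkcond B) (big_mkcond C) -!big_split /=.
apply: ler_sum => w _; have w_ge0 := kCM_weight_ge0 R w.
by have := cover w; case: (A w); case: (B w); case: (C w) => //= _; lra.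
Qed.

Lemma kCM_upper_moment (R : realType) n k : (0 < k)%N ->
  kCM_expect (fun w : samples n k => expR (2 * (kCM_L w)%:R))
    <= expR (8 * expR 1 * Num.sqrt (k * n)%:R) :> R.
Proof.
move=> k_gt0; rewrite (kCM_expect_L n (fun l => expR (2 * l%:R))) //.
under [X in code_expect _ _ X]funext => rs do rewrite expRM_natr.
exact: code_expect_expR_le.
Qed.

Lemma kCM_lower_moment (R : realType) n k (l : R) (S := Num.sqrt (k * n)%:R) :
  (0 < k)%N -> (0 < n)%N -> 0 < l ->
  kCM_expect (fun w : samples n k => expR (- (2 * l) * (kCM_L w)%:R))
    <= expR (- (l * S / ((1 + l) * (1 + S / n%:R)))).
Proof.
move=> k_gt0 n_gt0 l_gt0.
rewrite (kCM_expect_L n (fun j => expR (- (2 * l) * j%:R))) //.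
under [X in code_expect _ _ X]funext => rs do rewrite expRM_natr.
exact: code_expect_expRN_le.
Qed.

(** * The theorem *)

Lemma limn_esup_le_near (R : realType) (u : (\bar R)^nat) (l : \bar R) :
  (\forall n \near \oo, (u n <= l)%E) -> (limn_esup u <= l)%E.
Proof.
move=> u_le; rewrite /limn_esup limf_esupE.
apply: (@le_trans _ _ (ereal_sup [set u n | n in [set n | (u n <= l)%E]])).
  by apply: ereal_inf_lbound; exists [set n | (u n <= l)%E].
by apply: ge_ereal_sup => _ [n n_le <-].
Qed.

Lemma limn_einf_ge_near (R : realType) (u : (\bar R)^nat) (l : \bar R) :
  (\forall n \near \oo, (l <= u n)%E) -> (l <= limn_einf u)%E.
Proof.
move=> u_ge; rewrite /limn_einf leeNr; apply: limn_esup_le_near.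
by near=> n; rewrite leeN2; near: n.
Unshelve. all: by end_near. Qed.

(** sqrt(k n) / n = sqrt(k / n). *)
Lemma near_sqrt_ratio_le (R : realType) (k : nat -> nat) (d : R) :
  (fun n : nat => (k n)%:R : R^o) =o_\oo (fun n : nat => n%:R : R^o) ->
  0 < d -> \forall n \near \oo, Num.sqrt (k n * n)%:R / n%:R <= d.
Proof.
move=> /eqoP k_o d_gt0; have d2_gt0 : 0 < d ^+ 2 by rewrite exprn_gt0.
near=> n.
have n_gt0 : (0 < n)%N by near: n; exists 1%N.
have : `|(k n)%:R : R^o| <= d ^+ 2 * `|n%:R : R^o| by near: n; exact: k_o.
rewrite !normr_nat => k_le; rewrite ler_pdivrMr ?ltr0n //.
rewrite -(@ler_pXn2r _ 2) ?nnegrE ?sqrtr_ge0 ?mulr_ge0 ?(ltW d_gt0) //.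
by rewrite sqr_sqrtr // natrM exprMn [n%:R ^+ 2]expr2 mulrA ler_wpM2r.
Unshelve. all: by end_near. Qed.

Lemma inv_sqr_ge (R : realType) (d : R) : 0 <= d ->
  1 - 2 * d <= ((1 + d) * (1 + d))^-1.
Proof.
move=> d_ge0; rewrite -[X in _ <= X]mul1r ler_pdivlMr ?mulr_gt0 ?ltr_wpDr //.
have : 0 <= d * d * d by rewrite !mulr_ge0.
nra.
Qed.

Lemma expRN_le_inv (R : realType) (a : R) : 0 < a -> expR (- a) <= a^-1.
Proof.
move=> a_gt0; rewrite expRN lef_pV2 ?posrE ?expR_gt0 //.
by apply: le_trans (expR_ge1Dx a); rewrite lerDr.
Qed.

Theorem theorem5 (R : realType) (k : nat -> nat)
    (k_gt0 : forall n : nat, (0 < n)%N -> (0 < k n)%N)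
    (k_littleo : (fun n : nat => (k n)%:R : R^o) =o_\oo
                 (fun n : nat => n%:R : R^o)) :
  let ratio (n : nat) (w : samples n (k n)) : R :=
    (kCM_L w)%:R / Num.sqrt (k n * n)%:R in
  let mean_ratio (n : nat) : R :=
    kCM_expect (fun w : samples n (k n) => (kCM_L w)%:R) /
      Num.sqrt (k n * n)%:R in
  [/\ ((2^-1 : R)%:E <= limn_einf (fun n : nat => (mean_ratio n)%:E))%E,
      (limn_einf (fun n : nat => (mean_ratio n)%:E) <=
         limn_esup (fun n : nat => (mean_ratio n)%:E))%E,
      (limn_esup (fun n : nat => (mean_ratio n)%:E) <= (4 * expR 1 : R)%:E)%E
    & forall eps : R, 0 < eps ->
        kCM_prob R (fun w : samples n (k n) =>
          2^-1 - eps <= ratio n w <= 4 * expR 1 + eps) @[n --> \oo]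
          --> (1 : R)].
Proof.
move=> ratio mean_ratio.
pose S n : R := Num.sqrt (k n * n)%:R.
have S_gt0 n : (0 < n)%N -> 0 < S n.
  by move=> n_gt0; rewrite sqrtr_gt0 ltr0n muln_gt0 k_gt0.
have near_pos : \forall n \near \oo, (0 < n)%N by exists 1%N.
(* The lower moment once x <= d, with l = d: it loses the factor
   (1 + d) ^- 2 >= 1 - 2 d. *)
have low_moment d n : 0 < d -> (0 < n)%N -> S n / n%:R <= d ->
    kCM_expect (fun w : samples n (k n) => expR (- (2 * d) * (kCM_L w)%:R))
      <= expR (- (d * S n * (1 - 2 * d))).
  move=> d_gt0 n_gt0 S_le.
  apply: le_trans (kCM_lower_moment (k_gt0 n n_gt0) n_gt0 d_gt0) _.
  rewrite ler_expR lerN2 -/(S n).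
  have dS_ge0 : 0 <= d * S n by rewrite mulr_ge0 // ltW // S_gt0.
  apply: ler_wpM2l dS_ge0 _ _ _.
  apply: le_trans (inv_sqr_ge (ltW d_gt0)) _.
  have x_ge0 : 0 <= S n / n%:R by rewrite divr_ge0 // ltW // S_gt0.
  have d1_gt0 : 0 < 1 + d by rewrite addr_gt0.
  have x1_gt0 : 0 < 1 + S n / n%:R by rewrite ltr_pwDl.
  by rewrite lef_pV2 ?posrE ?mulr_gt0 // ler_wpM2l ?lerD2l // ltW.
split.
- apply/lee_addgt0Pr => d d_gt0; rewrite -leeBlDr //.
  apply: limn_einf_ge_near; near=> n.
  have n_gt0 : (0 < n)%N by near: n.
  have S_le : S n / n%:R <= d by near: n; exact: near_sqrt_ratio_le.
  rewrite -EFinB lee_fin /mean_ratio ler_pdivlMr ?S_gt0 //.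
  have := kCM_jensen (k_gt0 n n_gt0) (low_moment d n d_gt0 n_gt0 S_le).
  set EL := kCM_expect _; rewrite -/(S n) => EL_ge.
  rewrite -(@ler_pM2l _ (2 * d)) ?mulr_gt0 //.
  have -> : 2 * d * ((2^-1 - d) * S n) = d * S n * (1 - 2 * d) by field.
  lra.
- exact: limn_einf_sup.
- apply: limn_esup_le_near; near=> n.
  have n_gt0 : (0 < n)%N by near: n.
  rewrite lee_fin /mean_ratio ler_pdivrMr ?S_gt0 //.
  have := kCM_jensen (k_gt0 n n_gt0) (kCM_upper_moment R n (k_gt0 n n_gt0)).
  lra.
move=> eps eps_gt0; apply/cvgrPdist_le => eta eta_gt0 /=.
(* With d = eps / 2 the lower tail is at most e ^ (- 2 d ^ 2 S) and the upper
   tail at most e ^ (- 2 eps S); once S >= K, they sum to at most eta. *)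
pose d := eps / 2; have d_gt0 : 0 < d by rewrite divr_gt0.
pose K := ((2 * d * d)^-1 + (2 * eps)^-1) / eta.
near=> n.
have n_gt0 : (0 < n)%N by near: n.
have S_le : S n / n%:R <= d by near: n; exact: near_sqrt_ratio_le.
have S_pos := S_gt0 n n_gt0.
have S_ge : K <= S n.
  have K_ge0 : 0 <= K.
    rewrite divr_ge0 ?(ltW eta_gt0) // addr_ge0 ?invr_ge0 ?mulr_ge0 //.
    - exact: ltW.
    - exact: ltW.
    - exact: ltW.
  rewrite -(@ler_pXn2r _ 2) ?nnegrE ?sqrtr_ge0 // sqr_sqrtr //.
  apply: (@le_trans _ _ n%:R); last by rewrite ler_nat leq_pmull // k_gt0.
  by near: n; exact: nbhs_infty_ger.
set P := kCM_prob R _.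
have P_le1 : P <= 1 by exact: kCM_prob_le1 (k_gt0 n n_gt0).
pose low (w : samples n (k n)) := (kCM_L w)%:R < (2^-1 - eps) * S n.
pose high (w : samples n (k n)) := (4 * expR 1 + eps) * S n < (kCM_L w)%:R.
have low_le : kCM_prob R low <= (2 * d * d * S n)^-1.
  have := kCM_markov (t := - (2 * d) * ((2^-1 - eps) * S n))
    (low_moment d n d_gt0 n_gt0 S_le) (A := low).
  move=> /(_ _)/le_trans; apply.
    by move=> w /ltW low_w; rewrite ler_wnM2l // oppr_le0 mulr_ge0 // ltW.
  apply: le_trans (expRN_le_inv _); last by rewrite !mulr_gt0.
  rewrite ler_expR le_eqVlt; apply/orP; left; apply/eqP.
  by rewrite (_ : eps = 2 * d); [field | rewrite /d; field].
have high_le : kCM_prob R high <= (2 * eps * S n)^-1.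
  have := kCM_markov (t := 2 * ((4 * expR 1 + eps) * S n))
    (kCM_upper_moment R n (k_gt0 n n_gt0)) (A := high).
  move=> /(_ _)/le_trans; apply.
    by move=> w /ltW high_w; rewrite ler_wpM2l.
  apply: le_trans (expRN_le_inv _); last by rewrite !mulr_gt0.
  rewrite ler_expR le_eqVlt; apply/orP; left; apply/eqP.
  by rewrite -/(S n); ring.
have cover : 1 <= P + kCM_prob R low + kCM_prob R high.
  apply: kCM_prob_cover (k_gt0 n n_gt0) _ => w.
  rewrite /low /high /ratio -/(S n) ler_pdivlMr // ler_pdivrMr //.
  by case: ltP; case: ltP.
rewrite ger0_norm ?subr_ge0 //.
have tails : (2 * d * d * S n)^-1 + (2 * eps * S n)^-1 <= eta.
  have -> : (2 * d * d * S n)^-1 + (2 * eps * S n)^-1 = K * eta / S n.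
    by rewrite /K; field; rewrite !gt_eqF.
  by rewrite ler_pdivrMr // [K * _]mulrC ler_wpM2l // ltW.
lra.
Unshelve. all: by end_near. Qed.
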